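(* Let $S$ be a right coherent monoid and let $T$ be a retract of $S$. Then $T$ is right coherent.
   Context: Retract: a subset $T\subseteq S$ of a monoid $S$ is a retract of $S$ if there is a (semigroup) homomorphism $\varphi:S\to S$ with $\varphi^2=\varphi$ and image $\operatorname{Im}\varphi=T$. Any retract is a subsemigroup of $S$ and is itself a monoid (with identity $\varphi(1)$). Coherency: for a monoid $S$, a right $S$-act is a set $A$ with a map $A\times S\to A$, $(a,s)\mapsto as$, such that $a1=a$ and $a(st)=(as)t$ for all $a\in A$, $s,t\in S$ (the empty act is allowed). A right $S$-act is finitely presented if it is isomorphic to a quotient of a finitely generated free right $S$-act by a finitely generated congruence. The monoid $S$ is right coherent if every finitely generated subact of every finitely presented right $S$-act is finitely presented. *)

(* Defs.v *)
From HB Require Import structures.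
From mathcomp Require Import all_boot.
From mathcomp Require Import boolp classical_sets functions cardinality.

Set Implicit Arguments.
Unset Strict Implicit.
Unset Printing Implicit Defensive.

Local Open Scope group_scope.
Local Open Scope classical_set_scope.
Local Open Scope quotient_scope.

(** Right acts over a monoid. The carrier may be empty. As for [monoidType], it
    is required to be a [choiceType], which classically is no restriction. *)

HB.mixin Record isRightAct (S : monoidType) A := {
  ract : A -> S -> A;
  ract1 : forall a, ract a 1 = a;
  ractM : forall a s t, ract a (s * t) = ract (ract a s) t
}.

#[short(type="rightActType")]
HB.structure Definition RightAct (S : monoidType) :=
  {A of isRightAct S A & Choice A}.

Definition ract_isomorphic (S : monoidType) (A B : rightActType S) : Prop :=
  exists2 f : A -> B, bijective f & forall a s, f (ract a s) = ract (f a) s.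

Definition ract_finitely_generated (S : monoidType) (A : rightActType S) : Prop :=
  exists2 X : set A, finite_set X & [set ract x s | x in X & s in setT] = setT.

Section FreeAct.
Variables (S : monoidType) (n : nat).

(** The free right act on [n] generators: the generators are the [(i, 1)], and
    [(i, s)] is the [i]-th one acted on by [s]. *)
Definition free_ract : Type := ('I_n * S)%type.

HB.instance Definition _ := Choice.on free_ract.

Definition free_act (a : free_ract) (s : S) : free_ract := (a.1, a.2 * s).

Fact free_act1 a : free_act a 1 = a.
Proof. by case: a => i s; rewrite /free_act mulg1. Qed.

Fact free_actM a s t : free_act a (s * t) = free_act (free_act a s) t.
Proof. by rewrite /free_act mulgA. Qed.

HB.instance Definition _ := isRightAct.Build S free_ract free_act1 free_actM.

End FreeAct.

Record ract_congruence (S : monoidType) (A : rightActType S) := RactCongruence {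
  congruence_rel :> rel A;
  congruence_refl : reflexive congruence_rel;
  congruence_sym : symmetric congruence_rel;
  congruence_trans : transitive congruence_rel;
  congruence_act : forall a b s,
    congruence_rel a b -> congruence_rel (ract a s) (ract b s)
}.

(** [rho] is the smallest congruence containing a finite set of pairs. *)
Definition congruence_finitely_generated (S : monoidType) (A : rightActType S)
    (rho : ract_congruence A) : Prop :=
  exists2 H : set (A * A), finite_set H &
    (forall p, H p -> rho p.1 p.2) /\
    (forall sigma : ract_congruence A, (forall p, H p -> sigma p.1 p.2) ->
       forall a b, rho a b -> sigma a b).

Section QuotientAct.
Variables (S : monoidType) (A : rightActType S) (rho : ract_congruence A).

Definition congruence_equiv : equiv_rel A :=
  EquivRel rho (congruence_refl rho) (congruence_sym rho) (@congruence_trans _ _ rho).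

Definition quotient_ract : Type := {eq_quot congruence_equiv}.

HB.instance Definition _ := Choice.on quotient_ract.
HB.instance Definition _ := EqQuotient.on quotient_ract.

Definition quotient_act (q : quotient_ract) (s : S) : quotient_ract :=
  \pi_quotient_ract (ract (repr q) s).

Lemma quotient_act_pi (a : A) s :
  quotient_act (\pi_quotient_ract a) s = \pi_quotient_ract (ract a s).
Proof.
apply/eqmodP/congruence_act.
by have /eqmodP := reprK (\pi_quotient_ract a).
Qed.

Fact quotient_act1 q : quotient_act q 1 = q.
Proof. by rewrite /quotient_act ract1 reprK. Qed.

Fact quotient_actM q s t :
  quotient_act q (s * t) = quotient_act (quotient_act q s) t.
Proof. by rewrite [quotient_act q s]/quotient_act quotient_act_pi -ractM. Qed.

HB.instance Definition _ :=
  isRightAct.Build S quotient_ract quotient_act1 quotient_actM.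

End QuotientAct.

Definition ract_finitely_presented (S : monoidType) (A : rightActType S) : Prop :=
  exists (n : nat) (rho : ract_congruence (free_ract S n)),
    congruence_finitely_generated rho /\ ract_isomorphic A (quotient_ract rho).

Section Subact.
Variables (S : monoidType) (A : rightActType S).

Definition is_subact (B : set A) : Prop := forall b s, B b -> B (ract b s).

Variables (B : set A) (hB : is_subact B).

Definition subact of is_subact B : Type := set_type B.

HB.instance Definition _ := Choice.on (subact hB).

Fact subact_act_subproof (b : subact hB) s : ract (\val b) s \in B.
Proof. by apply/mem_set/hB/set_mem/valP. Qed.

Definition subact_act (b : subact hB) s : subact hB :=
  exist _ (ract (\val b) s) (subact_act_subproof b s).

Fact subact_act1 b : subact_act b 1 = b.
Proof. by apply: val_inj; rewrite /= ract1. Qed.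

Fact subact_actM b s t : subact_act b (s * t) = subact_act (subact_act b s) t.
Proof. by apply: val_inj; rewrite /= ractM. Qed.

HB.instance Definition _ :=
  isRightAct.Build S (subact hB) subact_act1 subact_actM.

End Subact.

Definition right_coherent (S : monoidType) : Prop :=
  forall A : rightActType S, ract_finitely_presented A ->
  forall (B : set A) (hB : is_subact B),
    ract_finitely_generated (subact hB) -> ract_finitely_presented (subact hB).

(** [phi] is a semigroup homomorphism: it need not preserve [1]. *)
Definition retraction_onto (S : monoidType) (T : set S)
    (phi : {multiplicative S -> S}) : Prop :=
  idempotent_fun phi /\ range phi = T.

Definition is_retract (S : monoidType) (T : set S) : Prop :=
  exists phi : {multiplicative S -> S}, retraction_onto T phi.

Section RetractMonoid.
Variables (S : monoidType) (T : set S) (hT : is_retract T).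

Lemma retraction_fix (phi : {multiplicative S -> S}) x :
  retraction_onto T phi -> T x -> phi x = x.
Proof. by case=> idem <- [y _ <-]; exact: idem. Qed.

Lemma retraction_in (phi : {multiplicative S -> S}) x :
  retraction_onto T phi -> T (phi x).
Proof. by case=> _ <-; exists x. Qed.

(** A retract as a monoid: the product of [S], and the unit [phi 1] for a
    retraction [phi] onto [T] (see [val_retract_one]), in general not [1]. *)
Definition retract_monoid of is_retract T : Type := set_type T.

HB.instance Definition _ := Choice.on (retract_monoid hT).

Let phi : {multiplicative S -> S} := projT1 (cid hT).
Let phiP : retraction_onto T phi := projT2 (cid hT).

Fact retract_mul_subproof (x y : retract_monoid hT) : \val x * \val y \in T.
Proof.
apply: mem_set; have /set_mem Tx := valP x; have /set_mem Ty := valP y.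
rewrite -(retraction_fix phiP Tx) -(retraction_fix phiP Ty) -gmulfM.
exact: retraction_in phiP.
Qed.

Definition retract_mul (x y : retract_monoid hT) : retract_monoid hT :=
  exist _ (\val x * \val y) (retract_mul_subproof x y).

Definition retract_one : retract_monoid hT :=
  exist _ (phi 1) (mem_set (retraction_in 1 phiP)).

Fact retract_mulA : associative retract_mul.
Proof. by move=> x y z; apply: val_inj; rewrite /= mulgA. Qed.

Fact retract_mul1 : left_id retract_one retract_mul.
Proof.
move=> x; apply: val_inj => /=; have /set_mem Tx := valP x.
by rewrite -{1}(retraction_fix phiP Tx) -gmulfM mul1g (retraction_fix phiP Tx).
Qed.

Fact retract_mulr1 : right_id retract_one retract_mul.
Proof.
move=> x; apply: val_inj => /=; have /set_mem Tx := valP x.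
by rewrite -{1}(retraction_fix phiP Tx) -gmulfM mulg1 (retraction_fix phiP Tx).
Qed.

HB.instance Definition _ :=
  isMonoid.Build (retract_monoid hT) retract_mulA retract_mul1 retract_mulr1.

Lemma val_retract_mul (x y : retract_monoid hT) :
  \val (x * y) = \val x * \val y.
Proof. by []. Qed.

Lemma val_retract_one (psi : {multiplicative S -> S}) :
  retraction_onto T psi -> \val (1 : retract_monoid hT) = psi 1.
Proof.
move=> psiP; have Te : T (phi 1) by apply: retraction_in phiP.
change (phi 1 = psi 1); have Tf := retraction_in 1 psiP.
rewrite -[LHS](retraction_fix psiP Te) -[phi 1]mul1g gmulfM.
rewrite (retraction_fix psiP Te) -(retraction_fix phiP Tf) -gmulfM mulg1.
by rewrite (retraction_fix phiP Tf).
Qed.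

End RetractMonoid.

(* Main.v *)
Require Import Defs.
From mathcomp Require Import all_boot.
From mathcomp Require Import boolp classical_sets functions cardinality.

(** A retraction [r] of [S] onto [T] turns every congruence on a free [T]-act
    into one on the free [S]-act on the same generators (pull back along [r]),
    and the inclusion restricts congruences from [S] to [T]. Hence the
    congruence generated over [S] by a set of pairs over [T] restricts to the
    congruence generated over [T]. So a finitely generated subact [B] of a
    finitely presented [T]-act lifts, with the same generators and relations,
    to a finitely generated subact of a finitely presented [S]-act; the
    relations between the lifted generators are finitely generated by coherence
    of [S], and their images under [r] generate the relations of [B]. *)

Set Implicit Arguments.
Unset Strict Implicit.
Unset Printing Implicit Defensive.

Local Open Scope group_scope.
Local Open Scope classical_set_scope.
Local Open Scope quotient_scope.

(** With [j := id] this is a morphism of acts; a general [j] covers maps between acts over different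
    monoids. *)
Definition semi_equivariant (S T : monoidType) (j : S -> T)
    (A : rightActType S) (B : rightActType T) (f : A -> B) : Prop :=
  forall a s, f (ract a s) = ract (f a) (j s).

Section PullbackCongruence.
Variables (S T : monoidType) (j : S -> T).
Variables (A : rightActType S) (B : rightActType T) (f : A -> B).
Hypothesis fj : semi_equivariant j f.
Variable sigma : ract_congruence B.

Let pull : rel A := fun a b => sigma (f a) (f b).

Fact pull_refl : reflexive pull.
Proof. by move=> a; exact: congruence_refl. Qed.

Fact pull_sym : symmetric pull.
Proof. by move=> a b; exact: congruence_sym. Qed.

Fact pull_trans : transitive pull.
Proof. by move=> b a c; exact: congruence_trans. Qed.

Fact pull_act a b s : pull a b -> pull (ract a s) (ract b s).
Proof. by rewrite /pull !fj; exact: congruence_act. Qed.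

Definition pull_congruence : ract_congruence A :=
  RactCongruence pull_refl pull_sym pull_trans pull_act.

End PullbackCongruence.

Section EqCongruence.
Variables (S : monoidType) (A : rightActType S).

Fact eq_congruence_trans : transitive (@eq_op A).
Proof. by move=> b a c /eqP-> /eqP->. Qed.

Fact eq_congruence_act (a b : A) (s : S) : a == b -> ract a s == ract b s.
Proof. by move=> /eqP->. Qed.

Definition eq_congruence : ract_congruence A :=
  RactCongruence (@eqxx A) (@eq_sym A) eq_congruence_trans eq_congruence_act.

End EqCongruence.

Definition ker_congruence (S : monoidType) (A B : rightActType S) (f : A -> B)
    (fS : semi_equivariant id f) : ract_congruence A :=
  pull_congruence fS (eq_congruence B).

Section GeneratedCongruence.
Variables (S : monoidType) (A : rightActType S) (H : set (A * A)).

(** Taken as the intersection of all congruences containing [H], so that minimality is immediate. *)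
Let gen : rel A := fun a b =>
  `[< forall sigma : ract_congruence A, (forall p, H p -> sigma p.1 p.2) ->
      sigma a b >].

Fact gen_refl : reflexive gen.
Proof. by move=> a; apply/asboolP => sigma _; exact: congruence_refl. Qed.

Fact gen_sym : symmetric gen.
Proof.
by move=> a b; apply/asboolP/asboolP => ab sigma Hs; rewrite congruence_sym ab.
Qed.

Fact gen_trans : transitive gen.
Proof.
move=> b a c /asboolP ab /asboolP bc; apply/asboolP => sigma Hs.
exact: congruence_trans (ab _ Hs) (bc _ Hs).
Qed.

Fact gen_act a b s : gen a b -> gen (ract a s) (ract b s).
Proof.
by move=> /asboolP ab; apply/asboolP => sigma Hs; exact/congruence_act/ab.
Qed.

Definition generated_congruence : ract_congruence A :=
  RactCongruence gen_refl gen_sym gen_trans gen_act.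

Lemma generated_congruence_sub p : H p -> generated_congruence p.1 p.2.
Proof. by move=> Hp; apply/asboolP => sigma; exact. Qed.

Lemma generated_congruence_min (sigma : ract_congruence A) :
  (forall p, H p -> sigma p.1 p.2) ->
  forall a b, generated_congruence a b -> sigma a b.
Proof. by move=> Hs a b /asboolP; exact. Qed.

Lemma generated_congruence_fg :
  finite_set H -> congruence_finitely_generated generated_congruence.
Proof.
move=> finH; exists H => //; split; first exact: generated_congruence_sub.
exact: generated_congruence_min.
Qed.

End GeneratedCongruence.

Section FreeLift.
Variables (S : monoidType) (n : nat) (A : rightActType S).

Definition free_lift (x : 'I_n -> A) (a : free_ract S n) : A := ract (x a.1) a.2.

Lemma free_lift_equivariant x : semi_equivariant id (free_lift x).
Proof. by move=> a s; rewrite /free_lift /= ractM. Qed.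

Lemma free_lift1 x i : free_lift x (i, 1) = x i.
Proof. exact: ract1. Qed.

Lemma equivariant_freeE (f : free_ract S n -> A) : semi_equivariant id f ->
  forall i s, f (i, s) = ract (f (i, 1)) s.
Proof. by move=> fS i s; rewrite -fS /ract /= /free_act /= mul1g. Qed.

End FreeLift.

Lemma surj_sig (A B : Type) (f : A -> B) :
  range f = setT -> exists g : B -> A, cancel g f.
Proof.
move=> fsurj; have /choice[g gK] : forall b, exists a, f a = b.
  by move=> b; have [a _ <-] : range f b; [rewrite fsurj|exists a].
by exists g.
Qed.

Lemma ract_fgP (S : monoidType) (A : rightActType S) :
  ract_finitely_generated A <->
  exists n (f : free_ract S n -> A), semi_equivariant id f /\ range f = setT.
Proof.
split=> [[X /finite_seqP[xs ->] gX]|[n [f [fS fsurj]]]].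
  exists (size xs), (free_lift (tnth (in_tuple xs))).
  split; first exact: free_lift_equivariant.
  apply/seteqP; split=> // a _.
  have : [set ract x s | x in [set` xs] & s in setT] a by rewrite gX.
  move=> [x /= /(tnthP (in_tuple xs)) [i ->]] [s _ <-].
  by exists (i, s).
exists (range (fun i => f (i, 1))); first exact/finite_image/finite_finset.
apply/seteqP; split=> // a _; have [[i s] _ <-] : range f a by rewrite fsurj.
by rewrite equivariant_freeE //; exists (f (i, 1)); [exists i|exists s].
Qed.

(** The first isomorphism theorem: a presentation is handled below as a surjection from a free act
    together with its kernel. *)
Lemma ract_fpP (S : monoidType) (A : rightActType S) :
  ract_finitely_presented A <->
  exists n (f : free_ract S n -> A) (fS : semi_equivariant id f),
    range f = setT /\ congruence_finitely_generated (ker_congruence fS).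
Proof.
split=> [[n [rho [[H finH [Hrho rho_min]] [f [g fK gK] fS]]]]|].
  have gS a s : g (ract a s) = ract (g a) s.
    by apply: (can_inj fK); rewrite fS !gK.
  pose h (x : free_ract S n) := g (\pi_(quotient_ract rho) x).
  have hS : semi_equivariant id h.
    by move=> x s; rewrite /h -gS; congr g; rewrite -quotient_act_pi.
  have hE x y : (h x == h y) = rho x y.
    by rewrite (can_eq gK) eqmodE.
  exists n, h, hS; split.
    apply/seteqP; split=> // a _; exists (repr (f a)) => //.
    by rewrite /h reprK fK.
  exists H => //; split=> [p /Hrho|sigma Hs a b].
    by rewrite -hE.
  by move=> ab; apply: rho_min => //; rewrite -hE.
move=> [n [f [fS [fsurj fg]]]]; have [g gK] := surj_sig fsurj.
exists n, (ker_congruence fS); split=> //.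
have piE x y : f x = f y <->
    \pi_(quotient_ract (ker_congruence fS)) x = \pi y.
  by split=> [xy|/eqmodP/eqP//]; apply/eqmodP/eqP.
exists (fun a => \pi_(quotient_ract (ker_congruence fS)) (g a)) => [|a s].
  exists (fun q => f (repr q)) => [a|q].
    by rewrite -[RHS]gK; apply/piE; rewrite reprK.
  by rewrite -[RHS]reprK; apply/piE; rewrite gK.
rewrite /ract /= quotient_act_pi; apply/piE.
by rewrite fS !gK.
Qed.

(** Finite presentability does not depend on the choice of the generators:
    besides the transported relations, it suffices to express each generator of
    the second family through the first one. *)
Lemma ker_congruence_fg (S : monoidType) (A : rightActType S) m
    (f : free_ract S m -> A) (fS : semi_equivariant id f) :
  ract_finitely_presented A -> range f = setT ->
  congruence_finitely_generated (ker_congruence fS).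
Proof.
move=> /ract_fpP[n [g [gS [gsurj [H finH [Hg g_min]]]]]] fsurj.
have [f' f'K] := surj_sig fsurj; have [g' g'K] := surj_sig gsurj.
(* By freeness, [P] lifts [g] through [f] and [Q] lifts [f] through [g]. *)
pose P := free_lift (fun i : 'I_n => f' (g (i, 1))).
pose Q := free_lift (fun k : 'I_m => g' (f (k, 1))).
have PS : semi_equivariant id P := free_lift_equivariant _.
have QS : semi_equivariant id Q := free_lift_equivariant _.
have fP x : f (P x) = g x.
  by case: x => i s; rewrite fS f'K -equivariant_freeE.
have gQ x : g (Q x) = f x.
  by case: x => k s; rewrite gS g'K -equivariant_freeE.
exists ([set (P p.1, P p.2) | p in H] `|`
        range (fun k : 'I_m => ((k, 1) : free_ract S m, P (Q (k, 1))))).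
  rewrite finite_setU; split; first exact: finite_image.
  exact/finite_image/finite_finset.
split=> [_ [[p Hp <-]|[k _ <-]]|sigma Hs x y /eqP fxy].
- by rewrite /= /pull_congruence /= !fP; exact: Hg.
- by rewrite /= fP gQ.
have PQ z : sigma z (P (Q z)).
  case: z => k s.
  have -> : (k, s) = ract ((k, 1) : free_ract S m) s.
    by rewrite /ract /= /free_act /= mul1g.
  by rewrite QS PS; apply: congruence_act; apply: (Hs (_, _)); right; exists k.
(* The chain is [x], [P (Q x)], [P (Q y)], [y]; its middle link is minimality of the kernel of [g],
   since [g (Q x) = g (Q y)]. *)
apply: congruence_trans (PQ x) _; rewrite congruence_sym.
apply: congruence_trans (PQ y) _; rewrite congruence_sym.
apply: (g_min (pull_congruence PS sigma)) => [p Hp|].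
  by apply: (Hs (_, _)); left; exists p.
by apply/eqP; rewrite !gQ.
Qed.

Definition free_map (S T : Type) n (j : S -> T) (a : 'I_n * S) : 'I_n * T :=
  (a.1, j a.2).

Lemma free_map_semi_equivariant (S T : monoidType) n (j : S -> T) :
  {morph j : x y / x * y} ->
  semi_equivariant j (free_map j : free_ract S n -> free_ract T n).
Proof. by move=> jM a s; rewrite /ract /= /free_act /free_map /= jM. Qed.

(** Stated for maps preserving products only, since the unit of a retract may differ from that of
    [S]. *)
Lemma right_coherent_retract (S T : monoidType) (iota : T -> S) (r : S -> T) :
  {morph iota : x y / x * y} -> {morph r : x y / x * y} -> cancel iota r ->
  right_coherent S -> right_coherent T.
Proof.
move=> iotaM rM iotaK cohS A /ract_fpP[n [g [gT [gsurj [H finH [Hg g_min]]]]]].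
move=> B hB /ract_fgP[m [h [hT hsurj]]].
have [g' g'K] := surj_sig gsurj.
apply/ract_fpP; exists m, h, hT; split=> //.
pose In : free_ract T n -> free_ract S n := free_map iota.
pose Im : free_ract T m -> free_ract S m := free_map iota.
pose Rn : free_ract S n -> free_ract T n := free_map r.
pose Rm : free_ract S m -> free_ract T m := free_map r.
have InM : semi_equivariant iota In := free_map_semi_equivariant iotaM.
have RnM : semi_equivariant r Rn := free_map_semi_equivariant rM.
have RmM : semi_equivariant r Rm := free_map_semi_equivariant rM.
have InK : cancel In Rn by case=> i t; rewrite /Rn /free_map /= iotaK.
have ImK : cancel Im Rm by case=> i t; rewrite /Rm /free_map /= iotaK.
pose rho := generated_congruence [set (In p.1, In p.2) | p in H].
have rho_fg : congruence_finitely_generated rho.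
  exact/generated_congruence_fg/finite_image.
(* [rhoI] and [rhoR] together say that [rho] restricts along [In] to the kernel of [g]. Each applies
   the minimality of one congruence to a pullback of the other. *)
have rhoI x y : g x = g y -> rho (In x) (In y).
  move=> /eqP gxy; apply: (g_min (pull_congruence InM rho)) => // p Hp.
  by apply: (@generated_congruence_sub _ _ _ (_, _)); exists p.
have rhoR x y : rho x y -> g (Rn x) = g (Rn y).
  move=> xy; apply/eqP.
  apply: (generated_congruence_min
            (sigma := pull_congruence RnM (ker_congruence gT)) _ xy).
  by move=> _ [p Hp <-]; rewrite /= !InK; exact: Hg.
(* [q k] represents the [k]-th generator of [B] in the free act over [A]'s generators; [qT] and [qS]
   extend this choice over [T] and over [S]. *)
pose q k := g' (\val (h (k, 1))).
pose qT := free_lift q.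
pose qS := free_lift (In \o q).
have gq x : g (qT x) = \val (h x).
  by case: x => k t; rewrite gT g'K (equivariant_freeE hT).
have qI x : qS (Im x) = In (qT x) by rewrite InM.
have qR x : Rn (qS x) = qT (Rm x) by rewrite RnM /= InK.
(* [C] is the lift of [A], and the range of [f] is the lift of [B]. *)
pose C : rightActType S := quotient_ract rho.
have C_fp : ract_finitely_presented C.
  exists n, rho; split=> //; exists id => //; exact: (Bijective (g := id)).
pose f (x : free_ract S m) : C := \pi_(quotient_ract rho) (qS x).
have fS x s : f (ract x s) = ract (f x) s.
  by rewrite /f [RHS]quotient_act_pi -free_lift_equivariant.
have fE x y : f x = f y <-> rho (qS x) (qS y).
  by split=> [/eqmodP|xy] //; apply/eqmodP.
have hD : is_subact (range f).
  by move=> _ s [x _ <-]; exists (ract x s).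
pose fD (x : free_ract S m) : subact hD := exist _ (f x) (mem_set (imageT f x)).
have fDS : semi_equivariant id fD by move=> x s; apply: val_inj => /=; rewrite fS.
have fDsurj : range fD = setT.
  apply/seteqP; split=> // -[d dP] _; have [x _ xd] := set_mem dP.
  by exists x => //; apply: val_inj.
have D_fp : ract_finitely_presented (subact hD).
  by apply: cohS C_fp _ _ _; apply/ract_fgP; exists m, fD.
have [K finK [Kf f_min]] := ker_congruence_fg fDS D_fp fDsurj.
exists [set (Rm p.1, Rm p.2) | p in K]; first exact: finite_image.
split=> [_ [p Kp <-]|sigma Ks x y /eqP hxy].
  (* A relation in [K] is a [rho]-relation between values of [qS]; [Rn] carries it to an equality in
     [A]. *)
  apply/eqP/val_inj; rewrite -!gq -!qR; apply: rhoR; apply/fE.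
  by have /eqP/(congr1 \val) := Kf _ Kp.
(* Once [x] and [y] are written as [Rm] of their lifts, it suffices that these lifts agree under
   [fD], which [rhoI] gives. *)
rewrite -(ImK x) -(ImK y); apply: (f_min (pull_congruence RmM sigma)).
  by move=> p Kp; apply: (Ks (_, _)); exists p.
by apply/eqP/val_inj/fE; rewrite !qI; apply: rhoI; rewrite !gq hxy.
Qed.

Theorem theorem6p3 (S : monoidType) (T : set S) (hT : is_retract T) :
  right_coherent S -> right_coherent (retract_monoid hT).
Proof.
(* This [phi] may differ from the retraction chosen inside [retract_monoid], but only products are
   compared below, and these come from [S]. *)
have [phi phiP] := hT.
pose r s : retract_monoid hT := exist _ (phi s) (mem_set (retraction_in s phiP)).
apply: (@right_coherent_retract _ _ (fun x : retract_monoid hT => \val x) r) => //.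
  by move=> s t; apply: val_inj => /=; rewrite gmulfM.
by move=> x; apply: val_inj; exact: (retraction_fix phiP (set_mem (valP x))).
Qed.
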